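(* Let $k\ge2$ be such that $r=2^k-1$ is prime, and let $q=2^k$. Then the integer group determinants of $GA(1,q)$ are exactly the integers of the form $$D=AB^{q-1},\qquad A,B\in\mathbb Z,$$ where either $r\nmid A$ or $r^2\mid A$, and $B\equiv A\pmod q$.
   Context: For a finite group $G=\{g_1,\dots,g_n\}$ and an element $\sum_{g\in G}a_g g$ of the group ring $\mathbb Z[G]$ (all $a_g\in\mathbb Z$), the group determinant is $D\left(\sum_{g\in G}a_g g\right)=\det\left(a_{g_ig_j^{-1}}\right)_{i,j=1}^n$. An integer group determinant of $G$ is any integer of this form. The general affine group of degree one over $\mathbb F_q$ is $GA(1,q)=\left\{\begin{pmatrix} a & b\\ 0 & 1\end{pmatrix}: a\in\mathbb F_q^*,\ b\in\mathbb F_q\right\}$ under matrix multiplication. *)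

(* Defs.v *)
From mathcomp Require Import all_boot all_order all_algebra all_fingroup.
Set Implicit Arguments. Unset Strict Implicit. Unset Printing Implicit Defensive.
Import GRing.Theory.
Local Open Scope ring_scope.

(* Group determinant of a finite subset G (intended: a subgroup) of a finite
   group gT, for integer coefficients a : gT -> int (only values on G matter).
   Elements of G are listed as g_i = enum_val i, i : 'I_#|G|. *)
Definition group_det (gT : finGroupType) (G : {set gT}) (a : gT -> int) : int :=
  \det (\matrix_(i < #|G|, j < #|G|)
          a ((enum_val i : gT) * (enum_val j : gT)^-1)%g).

Definition int_group_det (gT : finGroupType) (G : {set gT}) (D : int) : Prop :=
  exists a : gT -> int, D = group_det G a.

(* GA(1, F): invertible 2x2 matrices of the form [[a, b], [0, 1]] with a != 0
   (a != 0 is automatic from invertibility). *)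
Definition GA1 (F : finFieldType) : {set {'GL_2[F]}} :=
  [set g : {'GL_2[F]} | (GLval g 1 0 == 0) && (GLval g 1 1 == 1)].

(* Main.v *)
Require Import Defs.
From mathcomp Require Import all_boot all_order all_algebra all_fingroup all_field.
From mathcomp Require Import ring zify.
(** Let r = q - 1 and let zeta generate F^*.  Writing an element of GA(1,q) as
    [[zeta^i, zeta^i u], [0, 1]], the quotient g g'^-1 depends on the
    translation parts only through u - u', so the group matrix is an
    F-convolution of r x r blocks.  The characters psi(z x) of (F, +), where psi
    is a nontrivial character with values 1 and -1, diagonalise it: the
    determinant is the product over z in F of det M_z.  Here M_0 is a circulant
    matrix with determinant A, while the M_z with z != 0 are conjugate under the
    shift i -> i + 1 and share the determinant B, whence D = A B^(q-1).

    Congruence: z |-> det M_z is the Fourier transform of an integer function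
    on F, so A + (q-1) B = sum_z det M_z is divisible by q.
    Condition on A: with sigma the common row sum of the circulant, Frobenius over
    F_r shows that r | A forces r | sigma; adding up rows and then columns turns
    the last row and column into multiples of sigma, with corner r sigma, so
    r | sigma forces r^2 | A.

    Conversely M_1 may be changed by any integer matrix divisible by q without
    changing M_0.  Choosing the circulant M_0 = U of determinant A so that some
    integer combination of cofactors along a column is 1, a rank one
    perturbation of that column gives det M_1 = A + q s for an arbitrary s.  One
    takes U = 1 + P + ... + P^(m-1) + t J if r does not divide A, and
    U = 1 - P + t J if A = t r^2 (P the cyclic shift, J the all-ones matrix). *)
Set Implicit Arguments. Unset Strict Implicit. Unset Printing Implicit Defensive.
Import Order.TTheory GRing.Theory Num.Theory.
Local Open Scope ring_scope.

(** * Determinants of matrices indexed by a finite type *)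

Definition fdet (R : comNzRingType) (T : finType) (X : T -> T -> R) : R :=
  \det (\matrix_(i < #|T|, j < #|T|) X (enum_val i) (enum_val j)).

Section Fdet.
Variable R : comNzRingType.

(** The same permutation acts on rows and columns, so its sign enters twice and cancels. This makes
    determinants independent of the enumeration of the index set. *)
Lemma det_mxsub_inj n (f : 'I_n -> 'I_n) (A : 'M[R]_n) :
  injective f -> \det (mxsub f f A) = \det A.
Proof.
move=> injf; have -> : mxsub f f A = row_perm (perm injf) (col_perm (perm injf) A).
  by apply/matrixP=> i j; rewrite !mxE !permE.
rewrite row_permE col_permE !det_mulmx det_perm mulrC -mulrA det_perm.
by rewrite odd_permV -exprD addnn -signr_odd odd_double mulr1.
Qed.

Lemma fdet_bij n (T : finType) (f : 'I_n -> T) (X : T -> T -> R) :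
  bijective f -> \det (\matrix_(i < n, j < n) X (f i) (f j)) = fdet X.
Proof.
move=> bijf; have En : n = #|T| by rewrite -(bij_eq_card bijf) card_ord.
subst n; rewrite /fdet -[RHS](@det_mxsub_inj _ (fun i => enum_rank (f i))).
  by congr (\det _); apply/matrixP=> i j; rewrite !mxE !enum_rankK.
exact/(inj_comp enum_rank_inj)/bij_inj.
Qed.

Lemma eq_fdet (T : finType) (X Y : T -> T -> R) : X =2 Y -> fdet X = fdet Y.
Proof. by move=> eXY; congr (\det _); apply/matrixP=> i j; rewrite !mxE eXY. Qed.

Lemma fdet_mul (T : finType) (X Y : T -> T -> R) :
  fdet X * fdet Y = fdet (fun s t => \sum_k X s k * Y k t).
Proof.
rewrite /fdet -det_mulmx; congr (\det _); apply/matrixP=> i j; rewrite !mxE.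
rewrite (reindex_onto enum_rank enum_val) => [|k _]; last exact: enum_valK.
by apply: eq_big => [k|k _]; rewrite ?enum_rankK ?eqxx // !mxE enum_rankK.
Qed.

Lemma fdet_scale (T : finType) (c : R) (X : T -> T -> R) :
  fdet (fun s t => c * X s t) = c ^+ #|T| * fdet X.
Proof.
by rewrite /fdet -detZ; congr (\det _); apply/matrixP=> i j; rewrite !mxE.
Qed.

Lemma fdet1 (T : finType) : fdet (fun s t : T => (s == t)%:R : R) = 1.
Proof.
rewrite -[RHS](det1 R #|T|); congr (\det _); apply/matrixP=> i j.
by rewrite !mxE (inj_eq enum_val_inj).
Qed.

Lemma det_mxdiag m (p_ : 'I_m -> nat) (B : forall i, 'M[R]_(p_ i)) :
  \det (\mxdiag_i B i) = \prod_i \det (B i).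
Proof.
elim: m p_ B => [|m IHm] p_ B.
  have det0 k (M : 'M[R]_k) : k = 0 -> \det M = 1.
    by move=> k0; subst k; rewrite det_mx00.
  by rewrite det0 ?[RHS]big_ord0 // big_ord0.
rewrite mxdiag_recl [RHS]big_ord_recl -IHm -(det_ublock (B ord0) 0).
move: (block_mx _ _ _ _) => M.
by case: _ / mxsize_recl M => M; rewrite castmx_id.
Qed.

Lemma fdet_blocks (S : finType) n (M : S -> 'M[R]_n) :
  fdet (fun s t : S * 'I_n => (s.1 == t.1)%:R * M s.1 s.2 t.2) =
  \prod_s \det (M s).
Proof.
pose p_ (i : 'I_#|S|) := n.
pose f (k : 'I_(\sum_i p_ i)) : S * 'I_n :=
  (enum_val (tagnat.sig1 k), tagnat.sig2 k).
have bijf : bijective f.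
  exists (fun t => tagnat.rank (@Tagged _ (enum_rank t.1) (fun i => 'I_(p_ i)) t.2)).
    by move=> k; rewrite /f /= enum_valK -tagnat.sigE12 tagnat.sigK.
  by move=> [s i]; rewrite /f /tagnat.sig1 /tagnat.sig2 tagnat.rankK /= enum_rankK.
rewrite -(fdet_bij _ bijf).
transitivity (\det (\mxdiag_(i < #|S|) (M (enum_val i) : 'M_(p_ i)))).
  congr (\det _); apply/matrixP=> i j; rewrite !mxE /= (inj_eq enum_val_inj).
  case: eqP => [e|_]; last by rewrite mul0r mxE.
  rewrite mul1r; move: (tagnat.sig2 i) (tagnat.sig2 j).
  case: _ / e => a b.
  by rewrite conform_mx_id.
rewrite det_mxdiag [RHS](reindex_onto enum_val enum_rank) => [|s _]; last exact: enum_rankK.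
by apply: eq_big => i; rewrite ?enum_valK ?eqxx.
Qed.

End Fdet.

(* The subtraction i - j is the cyclic one of 'I_n.+2, i.e. modulo n.+2. *)
Definition circ (R : nzRingType) n (u : 'I_n.+2 -> R) : 'M[R]_n.+2 :=
  \matrix_(i, j) u (i - j).

(** * Circulant matrices over a commutative ring *)

Section Circulant.
Variable R : comNzRingType.

Lemma det_sum_rows n (M : 'M[R]_n.+1) :
  \det (\matrix_(i, j) if i == ord_max then \sum_k M k j else M i j) = \det M.
Proof.
pose T : 'M[R]_n.+1 := \matrix_(i, j) ((i == j) || (i == ord_max))%:R.
have detT : \det T = 1.
  rewrite det_trig => [|]; first by apply: big1 => i _; rewrite mxE eqxx.
  apply/is_trig_mxP=> i j ltij; rewrite mxE.
  have /negPf-> : i != j by rewrite -val_eqE /=; lia.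
  by have /negPf-> : i != ord_max by rewrite -val_eqE /=; have := ltn_ord j; lia.
rewrite -[RHS]mul1r -detT -det_mulmx; congr (\det _); apply/matrixP=> i j.
rewrite !mxE; case: eqP => [->|ni].
  by apply: eq_bigr => k _; rewrite mxE eqxx orbT mul1r.
rewrite (bigD1 i) //= mxE eqxx mul1r big1 ?addr0 // => k /negPf ki.
by rewrite mxE eq_sym ki (introF eqP ni) mul0r.
Qed.

Lemma det_sum_cols n (M : 'M[R]_n.+1) :
  \det (\matrix_(i, j) if j == ord_max then \sum_k M i k else M i j) = \det M.
Proof.
rewrite -[RHS]det_tr -[RHS]det_sum_rows -[LHS]det_tr; congr (\det _).
apply/matrixP=> i j; rewrite !mxE; case: eqP => // _.
by apply: eq_bigr => k _; rewrite mxE.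
Qed.

Lemma sum_shift n (u : 'I_n.+1 -> R) i : \sum_k u (i - k) = \sum_k u k.
Proof. by rewrite [RHS](reindex_inj (subrI i)). Qed.

Lemma sum_shiftr n (u : 'I_n.+1 -> R) i : \sum_k u (k - i) = \sum_k u k.
Proof. by rewrite [RHS](reindex_inj (addIr (- i))). Qed.

Lemma sum_delta (T : finType) (i : T) (f : T -> R) :
  \sum_k (k == i)%:R * f k = f i.
Proof.
rewrite (bigD1 i) //= eqxx mul1r big1 ?addr0 // => k /negPf->.
exact: mul0r.
Qed.

Lemma sum_delta1 (T : finType) (i : T) : \sum_k (k == i)%:R = 1 :> R.
Proof. by rewrite -[RHS](sum_delta i (fun=> 1)); apply: eq_bigr => k; rewrite mulr1. Qed.

Lemma circ_mul n (u v : 'I_n.+2 -> R) :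
  circ u *m circ v = circ (fun k => \sum_l u (k - l) * v l).
Proof.
apply/matrixP=> i j; rewrite !mxE.
rewrite [RHS](reindex_inj (addIr (- j))); apply: eq_bigr => k _.
by rewrite !mxE opprB addrA subrK.
Qed.

Lemma circ_shift_exp n k :
  circ (fun i : 'I_n.+2 => (i == 1)%:R : R) ^+ k = circ (fun i => (i == k%:R)%:R).
Proof.
elim: k => [|k IHk].
  by apply/matrixP=> i j; rewrite expr0 !mxE subr_eq0.
rewrite exprS IHk -mulmxE circ_mul; apply/matrixP=> i j; rewrite !mxE.
under eq_bigr do rewrite mulrC.
by rewrite sum_delta -(nat1r k) subr_eq.
Qed.

Lemma horner_mx_scaleXn n (P : 'M[R]_n.+1) c k :
  horner_mx P (c *: 'X^k) = c *: P ^+ k.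
Proof. by rewrite linearZ /= rmorphXn /= horner_mx_X. Qed.

(** Writing circulants as polynomials in the cyclic shift [P] moves computations into the
    commutative ring [{poly R}], where the Frobenius map is available. *)
Lemma circ_horner n (u : 'I_n.+2 -> R) :
  circ u = horner_mx (circ (fun i => (i == 1)%:R)) (\sum_(k < n.+2) u k *: 'X^k).
Proof.
rewrite raddf_sum; apply/matrixP=> i j; rewrite summxE mxE /=.
under eq_bigr do rewrite horner_mx_scaleXn circ_shift_exp !mxE natr_Zp eq_sym mulrC.
by rewrite sum_delta.
Qed.

(** In characteristic [r = n.+2] the [r]-th power is additive on polynomials in [P], and
    [P ^+ r = 1], so only the [r]-th powers of the coefficients remain. *)
Lemma circ_pFrobenius n (u : 'I_n.+2 -> R) : n.+2 \in [pchar R] ->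
  circ u ^+ n.+2 = ((\sum_k u k) ^+ n.+2)%:M.
Proof.
move=> charR; rewrite circ_horner -rmorphXn /=.
have charP : n.+2 \in [pchar {poly R}] by rewrite pchar_poly.
rewrite -(pFrobenius_autE charP) -(pFrobenius_autE charR) !rmorph_sum /=.
apply: eq_bigr => k _; rewrite !pFrobenius_autE exprZn.
rewrite -exprM horner_mx_scaleXn circ_shift_exp natrM.
rewrite [n.+2%:R](@pchar_Zp n.+2) // mulr0; apply/matrixP=> i j.
by rewrite !mxE subr_eq0 mulr_natr.
Qed.

Lemma det_exp n (M : 'M[R]_n.+1) k : \det (M ^+ k) = \det M ^+ k.
Proof.
elim: k => [|k IHk]; first by rewrite !expr0 det1.
by rewrite !exprS -mulmxE det_mulmx IHk.
Qed.

Lemma det_circ_pFrobenius n (u : 'I_n.+2 -> R) : n.+2 \in [pchar R] ->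
  (\det (circ u)) ^+ n.+2 = (\sum_k u k) ^+ (n.+2 * n.+2).
Proof. by move=> charR; rewrite -det_exp circ_pFrobenius // det_scalar -exprM. Qed.

End Circulant.

(** * Divisibility and explicit values of integer circulant determinants *)

Section IntCirculant.
Variable n : nat.
Implicit Types u : 'I_n.+2 -> int.
Local Notation r := n.+2.

(** Over ['F_r] the [r]-th power of the determinant is a power of the coefficient sum. *)
Lemma dvdz_sum_circ u : prime r ->
  (r%:Z %| \det (circ u))%Z -> (r%:Z %| \sum_k u k)%Z.
Proof.
move=> pr_r; have charF := pchar_Fp pr_r.
rewrite !(dvdz_pcharf charF) -det_map_mx.
have -> : map_mx intr (circ u) = circ (fun k => (u k)%:~R : 'F_r).
  by apply/matrixP=> i j; rewrite !mxE.
move=> /eqP det0; have := det_circ_pFrobenius (fun k => (u k)%:~R : 'F_r) charF.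
rewrite det0 expr0n => /esym/eqP; rewrite expf_eq0 /= => /eqP s0.
by rewrite rmorph_sum s0.
Qed.

Lemma dvdz_det_circ u :
  (r%:Z %| \sum_k u k)%Z -> ((r ^ 2)%N%:Z %| \det (circ u))%Z.
Proof.
case/dvdzP=> t sum_u.
(* [X] is what remains after taking [r] out of the last row and out of the last column; the corner
   [t * r ^ 2] loses both factors. *)
pose w (i : 'I_r) : int := if i == ord_max then r%:Z else 1.
pose X : 'M[int]_r := \matrix_(i, j)
  if (i == ord_max) || (j == ord_max) then t else u (i - j).
suff <- : \det (diag_mx (\row_i w i) *m X *m diag_mx (\row_i w i)) = \det (circ u).
  rewrite !det_mulmx det_diag.
  have -> : \prod_i (\row_i w i) 0 i = r%:Z.
    rewrite big_ord_recr /= !mxE {2}/w eqxx big1 ?mul1r // => i _.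
    rewrite mxE /w; case: eqP => // /(congr1 val) /= e.
    by have := ltn_ord i; rewrite e ltnn.
  by apply/dvdzP; exists (\det X); rewrite PoszM; ring.
rewrite -[RHS]det_sum_rows -[RHS]det_sum_cols; congr (\det _).
apply/matrixP=> i j; rewrite mul_mx_diag mul_diag_mx !mxE /w.
have sr k : \sum_l (circ u) k l = t * r.
  by rewrite -sum_u -(sum_shift u k); apply: eq_bigr => l _; rewrite mxE.
have sc k : \sum_l (circ u) l k = t * r.
  by rewrite -sum_u -(sum_shiftr u k); apply: eq_bigr => l _; rewrite mxE.
case: (altP (i =P _)) => [->|ni]; case: (altP (j =P _)) => [->|nj] /=.
- under eq_bigr do rewrite mxE eqxx sc.
  rewrite sumr_const card_ord -mulr_natr; ring.
- by rewrite sc; ring.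
- by under eq_bigr do rewrite mxE (negPf ni); rewrite sr; ring.
- by ring.
Qed.



(* Adding all rows to the last one gives U K below, with K easily triangularised. *)
Lemma det_circ_laplacian (t : int) :
  \det (circ (fun k : 'I_r => (k == 0)%:R - (k == 1)%:R + t)) = t * r%:Z ^+ 2.
Proof.
pose K : 'M[int]_r := \matrix_(i, j)
  if i == ord_max then 1 else (i == j)%:R - (i - j == 1)%:R.
pose U : 'M[int]_r := \matrix_(i, j)
  if i == ord_max then (j == ord_max)%:R * (t * r%:Z)
  else (i == j)%:R + (j == ord_max)%:R * t.
have detU : \det U = t * r%:Z.
  rewrite -det_tr det_trig; last first.
    apply/is_trig_mxP=> i j ltij; rewrite !mxE.
    have /negPf-> : i != ord_max by rewrite -val_eqE /=; have := ltn_ord j; lia.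
    have /negPf-> : j != i by rewrite -val_eqE /=; lia.
    by rewrite !mul0r addr0 if_same.
  rewrite big_ord_recr /= !mxE eqxx mul1r big1 ?mul1r // => i _; rewrite !mxE.
  have /negPf-> : widen_ord (leqnSn n.+1) i != ord_max.
    by rewrite -val_eqE /=; have := ltn_ord i; lia.
  by rewrite eqxx mul0r addr0.
have sum_row k : \sum_(l < r) ((k == l)%:R - (k - l == 1)%:R) = 0 :> int.
  rewrite sumrB (sum_shift (fun m => (m == 1)%:R)).
  by under eq_bigr do rewrite eq_sym; rewrite !sum_delta1 subrr.
have detK : \det K = r%:Z.
  (* The rows of [1 - P] sum to 0, so adding all columns to the last one clears it except for its
     corner [r]. *)
  rewrite -det_sum_cols det_trig; last first.
    apply/is_trig_mxP=> i j ltij; rewrite !mxE.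
    have /negPf ni : i != ord_max by rewrite -val_eqE /=; have := ltn_ord j; lia.
    case: eqP => [_|nj]; first by under eq_bigr do rewrite mxE ni; rewrite sum_row.
    rewrite ni; have /negPf-> : i != j by rewrite -val_eqE /=; lia.
    (* With [i < j], [i - j = 1] holds only by wrapping around, which forces [j] to be the last
       index. *)
    case: eqP => // /(canRL (subrK _)) /(congr1 val) /=.
    have jn : (j < n.+1)%N.
      by rewrite ltn_neqAle -ltnS ltn_ord andbT; apply/eqP => e; apply/nj/val_inj.
    rewrite modn_small; last by rewrite modn_small //=; lia.
    by rewrite modn_small //=; lia.
  rewrite big_ord_recr /= !mxE eqxx big1 ?mul1r.
    under eq_bigr do rewrite mxE eqxx.
 by rewrite sumr_const card_ord natz.
  move=> i _; rewrite !mxE.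
  have /negPf-> : widen_ord (leqnSn n.+1) i != ord_max.
    by rewrite -val_eqE /=; have := ltn_ord i; lia.
  by rewrite eqxx subrr.
rewrite expr2 mulrA -{2}detK -detU -det_mulmx -[LHS]det_sum_rows.
congr (\det _); apply/matrixP=> i j; rewrite !mxE.
case: eqP => [->|/eqP/negPf ni].
  under [RHS]eq_bigr do rewrite !mxE eqxx -mulrA.
  rewrite (sum_delta ord_max) eqxx mulr1.
  under eq_bigr do rewrite mxE.
  rewrite (sum_shiftr (fun k => (k == 0)%:R - (k == 1)%:R + t)).
  rewrite big_split sumrB /= !sum_delta1 subrr add0r.
  by rewrite sumr_const card_ord -mulr_natr natz.
under [RHS]eq_bigr do rewrite mxE ni mulrDl -mulrA [i == _]eq_sym.
rewrite big_split /= (sum_delta i (fun k => K k j)).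
rewrite (sum_delta ord_max (fun k => t * K k j)) !mxE ni eqxx mulr1.
by rewrite subr_eq0.
Qed.

Lemma det_mulr_unit_circ (u : 'I_r -> int) (c : 'I_r) : c \is a GRing.unit ->
  \det (circ (fun k => u (k * c))) = \det (circ u).
Proof.
move=> Uc; rewrite -[RHS](det_mxsub_inj _ (mulIr Uc)); congr (\det _).
by apply/matrixP=> i j; rewrite !mxE mulrBl.
Qed.

End IntCirculant.

(** * Rank one perturbations and circulants of prescribed determinant *)

(** Only column [j0] changes, so its cofactors do not. From [U y = det(U) v] one gets
    [adj(U) v = y], so expanding along [j0] adds [c * y j0 = c]. *)
Lemma det_add_rank1 (R : idomainType) n (U : 'M[R]_n) (v y : 'I_n -> R) j0 c :
    \det U != 0 -> (forall i, \sum_j U i j * y j = \det U * v i) -> y j0 = 1 ->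
  \det (\matrix_(i, j) (U i j + c * v i * (j == j0)%:R)) = \det U + c.
Proof.
move=> U0 Uy yj0; set U' := \matrix_(i, j) _.
have cofU i : cofactor U' i j0 = cofactor U i j0.
  congr (_ * \det _); apply/matrixP=> k l; rewrite !mxE.
  by rewrite eq_sym (negPf (neq_lift _ _)) mulr0 addr0.
have adjv : \sum_i v i * cofactor U i j0 = 1.
  apply: (mulfI U0); rewrite mulr1 mulr_sumr.
  have /(congr1 (fun M : 'cV_n => M j0 0)) :
      \adj U *m (U *m \col_j y j) = \det U *: \col_j y j.
    by rewrite mulmxA mul_adj_mx mul_scalar_mx.
  rewrite !mxE yj0 mulr1 => adjUy; rewrite -[RHS]adjUy.
  apply: eq_bigr => i _; rewrite !mxE mulrA -Uy mulrC; congr (_ * _).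
  by apply: eq_bigr => j _; rewrite mxE.
rewrite (expand_det_col U' j0) (expand_det_col U j0) -[c in RHS]mulr1 -adjv.
rewrite mulr_sumr -big_split /=; apply: eq_bigr => i _.
by rewrite cofU mxE eqxx mulr1 mulrDl mulrA.
Qed.

Section Realization.
Variable n : nat.
Local Notation r := n.+2.

(* If A != 0, the equations say that adj(U) v = y for U = circ u, so that
   y j0 = 1 is an expansion sum_i v i * cofactor U i j0 = 1 along column j0. *)
Definition circ_cofactor1 (A : int) : Prop :=
  exists (u v y : 'I_r -> int) (j0 : 'I_r),
    [/\ \det (circ u) = A, forall i, \sum_j u (i - j) * y j = A * v i & y j0 = 1].

Lemma val_pred_Zp (k : 'I_r) : k != 0 -> val (k - 1) = (val k).-1.
Proof.
move=> k0; have kpos : (0 < k)%N by rewrite lt0n.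
have ltk := ltn_ord k.
have lt1k : (k.-1 < r)%N by lia.
have -> : k - 1 = inord k.-1; last by rewrite /= inordK.
apply: (canLR (addrK 1)); apply: val_inj.
by rewrite /= inordK // [(1 %% _)%N]modn_small // addn1 prednK // modn_small.
Qed.

Lemma val_opp1_Zp : val (0 - 1 : 'I_r) = n.+1.
Proof. by rewrite sub0r /= subn1 modn_small // modn_small. Qed.

Lemma sum_ord_double m : (\sum_(i < m) val i).*2 = (m * m.-1)%N.
Proof.
elim: m => [|m IHm]; first by rewrite big_ord0.
by rewrite big_ord_recr doubleD IHm /=; case: m {IHm} => //= m; lia.
Qed.

Lemma sum_laplacian (t : int) (y : 'I_r -> int) i :
  \sum_j ((i - j == 0)%:R - (i - j == 1)%:R + t) * y j =
  y i - y (i - 1) + t * \sum_j y j.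
Proof.
have E j : (i - j == 1) = (j == i - 1) by rewrite subr_eq [RHS]eq_sym subr_eq addrC.
under eq_bigr do rewrite mulrDl mulrBl subr_eq0 (eq_sym i) E.
by rewrite big_split sumrB /= !sum_delta mulr_sumr.
Qed.

(* The first column y of adj(1 - P + t J) is a linear ramp of slope - t r and
   sum r, so it takes the value 1 in the middle. *)
Lemma circ_cofactor1_sqr (t : int) : odd r -> circ_cofactor1 (t * r%:Z ^+ 2).
Proof.
move=> odd_r; pose h := n.+1./2.
have h2 : n.+1 = h.*2 by rewrite /h; lia.
pose y (k : 'I_r) : int := 1 + t * r%:Z * h%:Z - t * r%:Z * k%:Z.
exists (fun k => (k == 0)%:R - (k == 1)%:R + t), (fun k => (k == 0)%:R), y, (inord h).
split; first exact: det_circ_laplacian.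
  have sum_y : \sum_k y k = r%:Z.
    have sum_val : (\sum_(k < r) val k = r * h)%N.
      by apply: double_inj; rewrite sum_ord_double /= h2 doubleMr.
    rewrite sumrB sumr_const card_ord -mulr_sumr -(big_morph Posz PoszD (erefl 0%:Z)).
    by rewrite sum_val PoszM -mulr_natr natz; ring.
  move=> i; rewrite sum_laplacian sum_y.
  have [->|i0] := eqVneq i 0; first by rewrite /y val_opp1_Zp /=; ring.
  rewrite /y val_pred_Zp // mulr0.
  have : (0 < i)%N by rewrite lt0n.
  by rewrite /=; case: (nat_of_ord i) => // m _; rewrite /= (intS m); ring.
by rewrite /y inordK; [ring|lia].
Qed.

(* Multiplying U = 1 + P + ... + P^(m-1) + s J by 1 - P + J telescopes to
   1 - P^m + A J, which is conjugate to 1 - P + A J by i -> m i. *)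
Lemma circ_cofactor1_coprime (A : int) :
  prime r -> ~~ (r%:Z %| A)%Z -> circ_cofactor1 A.
Proof.
move=> pr_r nrA; pose m := `|(A %% r)%Z|%N.
have mE : m%:Z = (A %% r)%Z by rewrite gez0_abs // modz_ge0.
have lt_mr : (m < r)%N by rewrite -ltz_nat mE ltz_pmod.
have m_gt0 : (0 < m)%N by rewrite lt0n -eqz_nat mE; apply: contra nrA => /eqP/dvdz_mod0P.
pose s := (A %/ r)%Z.
have AE : A = s * r%:Z + m%:Z by rewrite mE -divz_eq.
pose u (k : 'I_r) : int := (k < m)%N%:R + s.
have sum_u : \sum_k u k = A.
  rewrite big_split /= sumr_const card_ord -mulr_natr natz [RHS]AE addrC.
  congr (_ + _); rewrite -natr_sum natz -(big_mkord xpredT (fun k => (k < m)%N : nat)) /=.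
  rewrite (@big_cat_nat _ _ _ m) //=; last exact: ltnW.
  rewrite big_nat_cond (eq_bigr (fun=> 1%N)).
    rewrite -big_nat_cond sum_nat_const_nat big_nat_cond big1.
      by rewrite subn0 muln1 addn0.
    by move=> k /andP[/andP[le_mk _] _]; rewrite ltnNge le_mk.
  by move=> k /andP[/andP[_ ->]].
(* All row sums of [circ u] equal [A], so the all-ones vector serves as both [v] and [y]. *)
exists u, (fun=> 1), (fun=> 1), 0; split=> // [|i]; last first.
  by under eq_bigr do rewrite mulr1; rewrite sum_shift sum_u mulr1.
pose c : 'I_r := inord m.
have vc : val c = m by rewrite /= inordK.
have Uc : c \is a GRing.unit.
  by rewrite -(natr_Zp c) (@unitZpE r) // vc prime_coprime // gtnNdvd.
have r2 : r%:Z ^+ 2 != 0 by rewrite expf_neq0.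
(* Multiplied by [r ^ 2 = det(1 - P + J)], the goal compares a product of circulants with
   [det(1 - P + A J) = A r ^ 2]. *)
apply: (mulIf r2); rewrite -[RHS]det_circ_laplacian -[r%:Z ^+ 2 in LHS]mul1r.
rewrite -det_circ_laplacian mulrC -det_mulmx circ_mul.
rewrite -[RHS](@det_mulr_unit_circ _ _ c^-1) ?unitrV //.
congr (\det _); apply/matrixP=> i j; rewrite !mxE.
move: (i - j) => k; rewrite sum_laplacian sum_u mul1r; congr (_ + _).
rewrite !(can2_eq (divrK Uc) (mulrK Uc)) mul0r mul1r -(val_eqE k c) vc.
have [->|k0] := eqVneq k 0.
  by rewrite /u val_opp1_Zp m_gt0 ltnNge -ltnS lt_mr /= (ltn_eqF m_gt0) add0r addrK subr0.
rewrite /u val_pred_Zp //.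
have k_gt0 : (0 < k)%N by rewrite lt0n.
have -> : ((val k).-1 < m)%N = (k <= m)%N by rewrite /=; lia.
by rewrite opprD addrACA subrr addr0 /=; case: ltngtP.
Qed.

Lemma circ_cofactor1P (A : int) : prime r -> odd r ->
  ~~ (r%:Z %| A)%Z || ((r ^ 2)%N%:Z %| A)%Z -> circ_cofactor1 A.
Proof.
move=> pr_r odd_r /orP[|/dvdzP[t ->]]; first exact: circ_cofactor1_coprime.
by rewrite (_ : (r ^ 2)%N%:Z = r%:Z ^+ 2) ?PoszM //; apply: circ_cofactor1_sqr.
Qed.

End Realization.

(** * A nontrivial additive character with values 1 and -1 *)

Section Character.
Variables (F : finFieldType) (k : nat).
Hypotheses (k_gt0 : (0 < k)%N) (cardF : #|F| = (2 ^ k)%N).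

Definition abs_trace (x : F) : F := \sum_(i < k) x ^+ (2 ^ i).

Lemma pchar2_of_card : 2 \in [pchar F].
Proof. exact: card_finPcharP cardF isT. Qed.

Lemma abs_traceD : {morph abs_trace : x y / x + y}.
Proof.
move=> x y; rewrite /abs_trace -big_split; apply: eq_bigr => i _ /=.
elim: (nat_of_ord i) => [|j IHj]; first by rewrite !expr1.
rewrite expnSr !exprM IHj -!(pFrobenius_autE pchar2_of_card).
exact: rmorphD.
Qed.

(** Squaring permutes the summands cyclically, as [x ^+ (2 ^ k) = x]; hence the trace only takes the
    values 0 and 1. *)
Lemma abs_trace_sqr x : abs_trace x ^+ 2 = abs_trace x.
Proof.
rewrite -(pFrobenius_autE pchar2_of_card) /abs_trace rmorph_sum /=.
under [LHS]eq_bigr do rewrite pFrobenius_autE -exprM -expnSr.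
case: k k_gt0 cardF => // l _ cardFl.
by rewrite big_ord_recr [RHS]big_ord_recl /= -cardFl expf_card expr1 addrC.
Qed.

(** The trace is a polynomial of degree [2 ^ k.-1], too small to vanish on all of [F]. *)
Lemma abs_trace_nontrivial : exists x, abs_trace x != 0.
Proof.
apply/existsP; rewrite -negb_forall; apply/negP => /forallP tr0.
pose p : {poly F} := \sum_(i < k) 'X^(2 ^ i).
have sz_p : size p = (2 ^ k.-1).+1.
  rewrite /p; case: k k_gt0 => // l _.
  rewrite big_ord_recr /= addrC size_polyDl ?size_polyXn //.
  apply: leq_ltn_trans (size_sum _ _ _) _; rewrite ltnS.
  by apply/bigmax_leqP => i _; rewrite size_polyXn ltn_exp2l.
have p0 : p != 0 by rewrite -size_poly_eq0 sz_p.
have rootsF : all (root p) (enum F).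
  apply/allP => x _; move/eqP: (tr0 x); rewrite /root /p horner_sum /abs_trace => E.
  by under eq_bigr do rewrite hornerXn; rewrite E.
have := max_poly_roots p0 rootsF (enum_uniq F); rewrite -cardE cardF sz_p.
by rewrite ltnS leq_exp2l // -ltnS prednK // ltnn.
Qed.

(** Characteristic 2 allows values in [int], so the Fourier analysis needs no roots of unity beyond
    -1. *)
Definition sign_char (x : F) : int := (-1) ^+ (abs_trace x != 0).

Lemma sign_charD x y : sign_char (x + y) = sign_char x * sign_char y.
Proof.
have tr01 z : abs_trace z = 0 \/ abs_trace z = 1.
  have /eqP := abs_trace_sqr z; rewrite -subr_eq0 expr2 -{3}[abs_trace z]mulr1.
  by rewrite -mulrBr mulf_eq0 subr_eq0 => /orP[]/eqP; [left|right].
rewrite /sign_char abs_traceD; case: (tr01 x) (tr01 y) => -> [] ->;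
  rewrite ?add0r ?addr0 ?eqxx ?oner_eq0 //=.
by rewrite addrr_pchar2 ?pchar2_of_card // eqxx.
Qed.

Lemma sign_char0 : sign_char 0 = 1.
Proof.
rewrite /sign_char /abs_trace big1 ?eqxx // => i _.
by rewrite expr0n expn_eq0.
Qed.

Lemma sum_sign_char m : \sum_z sign_char (z * m) = (m == 0)%:R * #|F|%:Z.
Proof.
case: eqP => [->|/eqP m0].
  under eq_bigr do rewrite mulr0 sign_char0.
  by rewrite sumr_const mul1r natz.
rewrite mul0r; transitivity (\sum_z sign_char z).
  by rewrite [RHS](reindex_inj (mulIf m0)).
have [x trx] := abs_trace_nontrivial.
(* Translation by an element of nonzero trace flips every sign. *)
have : \sum_z sign_char z = - \sum_z sign_char z.
  rewrite {1}(reindex_inj (addrI x)) -sumrN; apply: eq_bigr => z _ /=.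
  by rewrite sign_charD {1}/sign_char trx expr1 mulN1r.
by move/eqP; rewrite -addr_eq0 -mulr2n mulrn_eq0 => /eqP.
Qed.

End Character.

(** * Fourier transform of integer functions on the additive group of [F] *)

Section Fourier.
Variables (F : finFieldType) (psi : F -> int).
Hypotheses (psi0 : psi 0 = 1) (psiD : {morph psi : x y / x + y >-> x * y}).
Hypothesis sum_psi : forall m, \sum_z psi (z * m) = (m == 0)%:R * #|F|%:Z.

Definition fourier (c : F -> int) (z : F) : int := \sum_m c m * psi (z * m).

Definition fourier_mx n (C : 'I_n -> 'I_n -> F -> int) (z : F) : 'M[int]_n :=
  \matrix_(i, j) fourier (C i j) z.

(** The character matrices satisfy [E E' = q], and [E X E'] is [q] times the block diagonal matrix
    of the [fourier_mx C z]. Since [E] need not be invertible over [int], a power of [q] is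
    cancelled at the end. *)
Lemma fdet_convolution n (C : 'I_n -> 'I_n -> F -> int) :
  fdet (fun s t : F * 'I_n => C s.2 t.2 (s.1 - t.1)) =
  \prod_z \det (fourier_mx C z).
Proof.
pose E (s t : F * 'I_n) : int := (t.2 == s.2)%:R * psi (s.1 * t.1).
pose E' (s t : F * 'I_n) : int := (s.2 == t.2)%:R * psi (- t.1 * s.1).
have pair_sum (f : F * 'I_n -> int) : \sum_p f p = \sum_u \sum_i f (u, i).
  by rewrite pair_big /=; apply: eq_bigr => -[].
have EE' : fdet E * fdet E' = #|F|%:Z ^+ #|{: F * 'I_n}|.
  rewrite fdet_mul -[RHS]mulr1 -(fdet1 _ {: F * 'I_n}) -fdet_scale.
  apply: eq_fdet => -[z i] [z' j] /=; rewrite pair_sum /E /E' /=.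
  under eq_bigr do under eq_bigr do rewrite -mulrA.
  under eq_bigr => u _.
    rewrite (sum_delta i (fun k => psi (z * u) * ((k == j)%:R * psi (- z' * u)))).
    rewrite mulrCA -psiD -mulrDl [(z - z') * u]mulrC; over.
  rewrite -mulr_sumr sum_psi subr_eq0 xpair_eqE -mulnb natrM mulrA mulrC.
  by rewrite [_%:R * _%:R]mulrC.
pose EX (s t : F * 'I_n) := psi (s.1 * t.1) * fourier_mx C s.1 s.2 t.2.
have EXE : fdet E * fdet (fun s t : F * 'I_n => C s.2 t.2 (s.1 - t.1)) = fdet EX.
  rewrite fdet_mul; apply: eq_fdet => -[z i] [v j]; rewrite pair_sum /E /EX /=.
  under eq_bigr do under eq_bigr do rewrite -mulrA.
  under eq_bigr => u _.
    rewrite (sum_delta i (fun k => psi (z * u) * C k j (u - v))); over.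
  rewrite (reindex_inj (addIr v)) mxE mulr_sumr; apply: eq_bigr => u _ /=.
  by rewrite addrK mulrDr psiD; ring.
have EXE' : fdet EX * fdet E' =
    #|F|%:Z ^+ #|{: F * 'I_n}| * \prod_z \det (fourier_mx C z).
  rewrite -fdet_blocks -fdet_scale fdet_mul.
  apply: eq_fdet => -[z i] [z' j]; rewrite pair_sum /EX /E' /=.
  under eq_bigr => u _.
    under eq_bigr do rewrite mulrCA.
    rewrite (sum_delta j (fun k => psi (z * u) * fourier_mx C z i k * psi (- z' * u))).
    rewrite mulrAC -psiD -mulrDl [(z - z') * u]mulrC; over.
  by rewrite -mulr_suml sum_psi subr_eq0 mulrA [_%:R * _]mulrC.
have q0 : #|F|%:Z ^+ #|{: F * 'I_n}| != 0.
  by rewrite expf_neq0 // -lt0n; apply/card_gt0P; exists 0.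
apply: (mulfI q0); rewrite -EXE' -EXE -EE'; ring.
Qed.

(** This class is a ring, products corresponding to convolutions, so it is stable under taking
    determinants. *)
Definition fourier_integral (f : F -> int) := exists c, f =1 fourier c.

Lemma eq_fourier_integral f g : f =1 g -> fourier_integral f -> fourier_integral g.
Proof. by move=> fg [c fc]; exists c => z; rewrite -fg. Qed.

Lemma fourier_integral_const a : fourier_integral (fun=> a).
Proof.
exists (fun m => (m == 0)%:R * a) => z; rewrite /fourier.
under eq_bigr do rewrite -mulrA.
by rewrite (sum_delta 0 (fun m => a * psi (z * m))) mulr0 psi0 mulr1.
Qed.

Lemma fourier_integralD f g : fourier_integral f -> fourier_integral g ->
  fourier_integral (fun z => f z + g z).
Proof.
move=> [c fc] [d gd]; exists (fun m => c m + d m) => z.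
by rewrite fc gd -big_split; apply: eq_bigr => m _; rewrite mulrDl.
Qed.

Lemma fourier_integralM f g : fourier_integral f -> fourier_integral g ->
  fourier_integral (fun z => f z * g z).
Proof.
move=> [c fc] [d gd]; exists (fun m => \sum_l c l * d (m - l)) => z.
rewrite fc gd /fourier; under [RHS]eq_bigr do rewrite mulr_suml.
rewrite exchange_big mulr_suml /=; apply: eq_bigr => l _.
rewrite [RHS](reindex_inj (addIr l)) mulr_sumr /=; apply: eq_bigr => m _.
by rewrite addrK mulrDr psiD; ring.
Qed.

Lemma fourier_integral_sum (I : Type) (s : seq I) (f : I -> F -> int) :
  (forall i, fourier_integral (f i)) ->
  fourier_integral (fun z => \sum_(i <- s) f i z).
Proof.
move=> fP; elim: s => [|i s IHs].
  by apply: eq_fourier_integral (fourier_integral_const 0) => z; rewrite big_nil.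
by apply: eq_fourier_integral (fourier_integralD (fP i) IHs) => z; rewrite big_cons.
Qed.

Lemma fourier_integral_prod (I : Type) (s : seq I) (f : I -> F -> int) :
  (forall i, fourier_integral (f i)) ->
  fourier_integral (fun z => \prod_(i <- s) f i z).
Proof.
move=> fP; elim: s => [|i s IHs].
  by apply: eq_fourier_integral (fourier_integral_const 1) => z; rewrite big_nil.
by apply: eq_fourier_integral (fourier_integralM (fP i) IHs) => z; rewrite big_cons.
Qed.

(** Fourier inversion at 0: the sum is [#|F|] times the coefficient [c 0]. *)
Lemma dvdz_sum_fourier_integral f :
  fourier_integral f -> (#|F|%:Z %| \sum_z f z)%Z.
Proof.
move=> [c fc]; apply/dvdzP; exists (c 0).
under eq_bigr do rewrite fc; rewrite exchange_big /=.
under eq_bigr do rewrite -mulr_sumr sum_psi mulrCA.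
by rewrite sum_delta.
Qed.

Lemma dvdz_sum_det_fourier n (C : 'I_n -> 'I_n -> F -> int) :
  (#|F|%:Z %| \sum_z \det (fourier_mx C z))%Z.
Proof.
apply: dvdz_sum_fourier_integral; apply: fourier_integral_sum => s.
apply: fourier_integralM; first exact: fourier_integral_const.
apply: fourier_integral_prod => i; exists (C i (s i)) => z.
by rewrite mxE.
Qed.

End Fourier.

(** * Coordinates on GA(1,q) and its group matrix *)

Section AffineGroup.
Variables (F : finFieldType) (n : nat) (zeta : F).
Local Notation r := n.+2.
Hypotheses (prim_zeta : r.-primitive_root zeta) (cardF : #|F| = n.+3).

Definition aff_mx (c m : F) : 'M[F]_2 :=
  \matrix_(i, j) if i == 0 then if j == 0 then c else m else (j != 0)%:R.

Lemma aff_mx_mul c m c' m' :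
  aff_mx c m *m aff_mx c' m' = aff_mx (c * c') (c * m' + m).
Proof.
apply/matrixP=> i j; rewrite !mxE !big_ord_recr big_ord0 /= !mxE /=.
by case: i j => [[|[|//]] ?] [[|[|//]] ?] /=; rewrite ?mulr1 ?mul0r ?mulr0 ?add0r ?addr0.
Qed.

Lemma aff_mx_unit c m : c != 0 -> aff_mx c m \in unitmx.
Proof.
move=> c0; apply: (mulmx1_unit (B := aff_mx c^-1 (- c^-1 * m)) _).1.
rewrite aff_mx_mul mulNr mulrN mulVKf // addNr divff //.
by apply/matrixP => -[[|[|//]] ?] [[|[|//]] ?]; rewrite !mxE.
Qed.

(* Junk value 1 when c = 0. *)
Definition aff_gl (c m : F) : {'GL_2[F]} := insubd (1%g : {'GL_2[F]}) (aff_mx c m).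

Lemma aff_glE c m : c != 0 -> GLval (aff_gl c m) = aff_mx c m.
Proof. by move=> c0; apply: insubdK; apply: aff_mx_unit. Qed.

Lemma GA1_aff_gl c m : c != 0 -> aff_gl c m \in GA1 F.
Proof. by move=> c0; rewrite inE aff_glE // !mxE !eqxx. Qed.

Lemma GA1P (g : {'GL_2[F]}) : g \in GA1 F ->
  GLval g 0 0 != 0 /\ g = aff_gl (GLval g 0 0) (GLval g 0 1).
Proof.
rewrite inE => /andP[/eqP g10 /eqP g11].
have gE : GLval g = aff_mx (GLval g 0 0) (GLval g 0 1).
  have ord2 (i : 'I_2) : i = 0 \/ i = 1.
    by case: i => -[|[|//]] ?; [left|right]; apply: val_inj.
  by apply/matrixP => i j; rewrite !mxE; case: (ord2 i) (ord2 j) => -> [] ->.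
have g00 : GLval g 0 0 != 0.
  have gU : GLval g \in unitmx by exact: GL_unit.
  apply: contraTneq gU => g0; rewrite gE g0 unitmxE.
  rewrite -det_tr det_trig.
    by rewrite big_ord_recl mxE mxE /= mul0r unitr0.
  by apply/is_trig_mxP => -[[|[|//]] ?] [[|[|//]] ?] // _; rewrite !mxE.
by split=> //; apply: val_inj; rewrite [RHS]aff_glE.
Qed.

Lemma prim_expD (i j : 'I_r) : zeta ^+ (i + j)%R = zeta ^+ i * zeta ^+ j.
Proof. by rewrite /= prim_expr_mod // exprD. Qed.

Lemma prim_neq0 : zeta != 0.
Proof.
apply/eqP => z0; have /eqP := prim_expr_order prim_zeta.
by rewrite z0 expr0n eq_sym oner_eq0.
Qed.

Lemma prim_exp_neq0 i : zeta ^+ i != 0.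
Proof. exact/expf_neq0/prim_neq0. Qed.

Lemma prim_expB (i j : 'I_r) : zeta ^+ (i - j)%R = zeta ^+ i / zeta ^+ j.
Proof. by apply: (canRL (mulfK (prim_exp_neq0 j))); rewrite -prim_expD subrK. Qed.

Lemma prim_exp_inj : injective (fun i : 'I_r => zeta ^+ i).
Proof.
move=> i j /eqP; rewrite (eq_prim_root_expr prim_zeta) !modn_small // => /eqP.
exact: val_inj.
Qed.

Lemma prim_log (z : F) : z != 0 -> {l : 'I_r | z = zeta ^+ l}.
Proof.
move=> z0; apply: (prim_rootP prim_zeta).
by apply: (mulfI z0); rewrite mulr1 -exprS -cardF expf_card.
Qed.

Definition GA1_elt (t : F * 'I_r) : {'GL_2[F]} :=
  aff_gl (zeta ^+ t.2) (zeta ^+ t.2 * t.1).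

Lemma GA1_elt_inj : injective GA1_elt.
Proof.
move=> [u i] [v j] /(congr1 GLval); rewrite !aff_glE ?prim_exp_neq0 //= => E.
have := congr1 (fun M : 'M_2 => M 0 0) E; have := congr1 (fun M : 'M_2 => M 0 1) E.
rewrite !mxE /= => + /prim_exp_inj eij; rewrite eij.
by move/(mulfI (prim_exp_neq0 _)) ->.
Qed.

Lemma GA1_elt_div s t :
  (GA1_elt s * (GA1_elt t)^-1)%g =
  aff_gl (zeta ^+ (s.2 - t.2)%R) (zeta ^+ s.2 * (s.1 - t.1)).
Proof.
apply: (canLR (mulgK _)); apply: val_inj.
transitivity (GLval (aff_gl (zeta ^+ (s.2 - t.2)%R) (zeta ^+ s.2 * (s.1 - t.1)))
              *m GLval (GA1_elt t)); last by [].
rewrite [LHS]aff_glE ?prim_exp_neq0 // !aff_glE ?prim_exp_neq0 //.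
rewrite aff_mx_mul prim_expB divfK ?prim_exp_neq0 // mulrA divfK ?prim_exp_neq0 //.
by rewrite mulrBr subrKC.
Qed.

Definition GA1_coef (a : {'GL_2[F]} -> int) (i j : 'I_r) (m : F) : int :=
  a (aff_gl (zeta ^+ (i - j)%R) (zeta ^+ i * m)).

Lemma group_det_GA1 a :
  group_det (GA1 F) a =
  fdet (fun s t : F * 'I_r => GA1_coef a s.2 t.2 (s.1 - t.1)).
Proof.
have surj g : g \in GA1 F -> {t | g == GA1_elt t}.
  move=> /GA1P[c0 gE]; have [l lE] := prim_log c0.
  exists (GLval g 0 1 / zeta ^+ l, l); apply/eqP; rewrite {1}gE /GA1_elt /= -lE.
  by rewrite mulrC divfK.
have GAelt t : GA1_elt t \in GA1 F by rewrite GA1_aff_gl ?prim_exp_neq0.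
pose f (i : 'I_#|GA1 F|) := sval (surj _ (enum_valP i)).
have fE i : GA1_elt (f i) = enum_val i by apply/esym/eqP/(svalP (surj _ (enum_valP i))).
have bijf : bijective f.
  exists (fun t => enum_rank_in (GAelt t) (GA1_elt t)) => [i|t].
    by apply: enum_val_inj; rewrite enum_rankK_in fE ?enum_valP.
  by apply: GA1_elt_inj; rewrite fE enum_rankK_in.
rewrite -(fdet_bij _ bijf); congr (\det _); apply/matrixP=> i j.
by rewrite !mxE -!fE GA1_elt_div.
Qed.

(** With [z = zeta ^+ l], substituting [z * m] for [m] turns [M_1] with both indices shifted by
    [- l] into [M_z]. *)
Lemma det_fourier_mx_const psi a z : z != 0 ->
  \det (fourier_mx psi (GA1_coef a) z) = \det (fourier_mx psi (GA1_coef a) 1).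
Proof.
move=> z0; have [l zE] := prim_log z0.
rewrite -[RHS](det_mxsub_inj _ (addIr (- l))); congr (\det _).
apply/matrixP => i j; rewrite !mxE /fourier [RHS](reindex_inj (mulfI z0)) /=.
apply: eq_bigr => m _; rewrite mul1r /GA1_coef opprD opprK addrACA addNr addr0.
by rewrite (prim_expB i l) -zE mulrA divfK.
Qed.

(** At the trivial character, the factor [zeta ^+ i] in the translation part is absorbed by
    reindexing, so entries depend on [i - j] only. *)
Lemma fourier_mx_GA1_0 psi a : psi 0 = 1 ->
  fourier_mx psi (GA1_coef a) 0 =
  circ (fun k => \sum_m a (aff_gl (zeta ^+ k) m)).
Proof.
move=> psi0; apply/matrixP=> i j; rewrite !mxE.
rewrite [RHS](reindex_inj (mulfI (prim_exp_neq0 i))).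
by apply: eq_bigr => m _; rewrite mul0r psi0 mulr1.
Qed.

End AffineGroup.

(** * The integer group determinants of GA(1,q) *)

Section GroupDeterminant.
Variables (F : finFieldType) (n : nat) (zeta : F) (psi : F -> int).
Local Notation r := n.+2.
Hypotheses (pr_r : prime r) (odd_r : odd r).
Hypotheses (prim_zeta : r.-primitive_root zeta) (cardF : #|F| = n.+3).
Hypotheses (psi0 : psi 0 = 1) (psiD : {morph psi : x y / x + y >-> x * y}).
Hypothesis sum_psi : forall m, \sum_z psi (z * m) = (m == 0)%:R * #|F|%:Z.

Lemma prod_det_fourier (a : {'GL_2[F]} -> int) :
  group_det (GA1 F) a =
  \det (circ (fun k : 'I_r => \sum_m a (aff_gl (zeta ^+ k) m))) *
  \det (fourier_mx psi (GA1_coef zeta a : 'I_r -> _) 1) ^+ r.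
Proof.
rewrite (group_det_GA1 prim_zeta cardF) (fdet_convolution psiD sum_psi).
rewrite (bigD1 0) //= (fourier_mx_GA1_0 prim_zeta _ psi0); congr (_ * _).
under eq_bigr do rewrite (det_fourier_mx_const prim_zeta cardF) //.
by rewrite prodr_const cardC1 cardF.
Qed.

Lemma GA1_det_congr (a : {'GL_2[F]} -> int) :
  (\det (fourier_mx psi (GA1_coef zeta a : 'I_r -> _) 1%R) ==
   \det (circ (fun k : 'I_r => \sum_m a (aff_gl (zeta ^+ k) m)))
     %[mod n.+3%:Z])%Z.
Proof.
have := dvdz_sum_det_fourier psi0 psiD sum_psi (GA1_coef zeta a : 'I_r -> _).
rewrite (bigD1 0) //= (fourier_mx_GA1_0 prim_zeta _ psi0).
under eq_bigr do rewrite (det_fourier_mx_const prim_zeta cardF) //.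
rewrite sumr_const cardC1 cardF -mulr_natr natz eqz_mod_dvd /=.
set A := \det _; set B := \det _; case/dvdzP => c E.
(* [B - A = q B - (A + (q - 1) B)], and the bracket is [c q]. *)
by apply/dvdzP; exists (B - c); rewrite mulrBl -E (intS n.+2); ring.
Qed.

Lemma GA1_det_realize (A s : int) : A != 0 -> circ_cofactor1 n A ->
  int_group_det (GA1 F) (A * (A + s * #|F|%:Z) ^+ r).
Proof.
move=> A0 [u [v [y [j0 [detu uy yj0]]]]].
(* The second term sums to 0 over m, so it does not affect M_0, and in M_1 it
   is picked up exactly in column j0, with weight #|F|. *)
pose b (k : 'I_r) (m : F) : int :=
  (m == 0)%:R * u k + s * v (k + j0) * psi (- (m / zeta ^+ (k + j0)%R)).
pose a (g : {'GL_2[F]}) : int :=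
  \sum_(k < r) (GLval g 0 0 == zeta ^+ k)%:R * b k (GLval g 0 1).
have aE (k : 'I_r) m : a (aff_gl (zeta ^+ k) m) = b k m.
  rewrite /a aff_glE ?(prim_exp_neq0 prim_zeta) //.
  under eq_bigr do rewrite !mxE /= (inj_eq (prim_exp_inj prim_zeta)) eq_sym.
  exact: sum_delta.
have sum_b w c : \sum_m psi (m * w) * c = (w == 0)%:R * (c * #|F|%:Z).
  by rewrite -mulr_suml sum_psi; ring.
exists a; rewrite prod_det_fourier.
have -> : circ (fun k : 'I_r => \sum_m a (aff_gl (zeta ^+ k) m)) = circ u.
  apply/matrixP=> i j; rewrite !mxE; under eq_bigr do rewrite aE /b.
  rewrite big_split /= (sum_delta 0 (fun=> u _)).
  under eq_bigr do rewrite -mulrN mulrC.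
  rewrite sum_b oppr_eq0 invr_eq0 (negPf (prim_exp_neq0 prim_zeta _)).
  by rewrite mul0r addr0.
have -> : fourier_mx psi (GA1_coef zeta a : 'I_r -> _) 1 = \matrix_(i, j)
    (circ u i j + s * #|F|%:Z * v i * (j == j0)%:R).
  apply/matrixP=> i j; rewrite !mxE /fourier.
  (* The phases combine to [m * (1 - zeta ^+ (j - j0))], whose character sum vanishes unless
     [j = j0]; there the index [i - j + j0] of [v] is [i]. *)
  have entry m : GA1_coef zeta a i j m * psi (1 * m) = (m == 0)%:R * (u (i - j) * psi m)
      + psi (m * (1 - zeta ^+ (j - j0)%R)) * (s * v (i - j + j0)).
    rewrite /GA1_coef aE /b mul1r mulf_eq0 (negPf (prim_exp_neq0 prim_zeta _)) orFb.
    have -> : i - j + j0 = i - (j - j0) by rewrite opprB addrA addrAC.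
    rewrite (prim_expB prim_zeta i (j - j0)) invf_div [zeta ^+ i * m]mulrC mulrACA.
    by rewrite divff ?(prim_exp_neq0 prim_zeta) // mulr1 mulrBr mulr1 psiD; ring.
  under eq_bigr do rewrite entry.
  rewrite big_split /= (sum_delta 0 (fun m => u (i - j) * psi m)) psi0 mulr1 sum_b.
  have nz := prim_exp_neq0 prim_zeta j0.
  rewrite subr_eq0 eq_sym (prim_expB prim_zeta) (can2_eq (divfK nz) (mulfK nz)) mul1r.
  rewrite (inj_eq (prim_exp_inj prim_zeta) j j0).
  by case: eqP => [->|_]; rewrite ?subrK ?mul0r ?mulr0 ?addr0 //; ring.
rewrite (det_add_rank1 (y := y)) ?detu // => i; rewrite -uy.
by apply: eq_bigr => j _; rewrite mxE.
Qed.

Lemma int_group_det_GA1 (D : int) :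
  int_group_det (GA1 F) D <->
  exists A B : int,
    [/\ D = A * B ^+ r, ~~ (r%:Z %| A)%Z || ((r ^ 2)%N%:Z %| A)%Z
      & (B == A %[mod n.+3%:Z])%Z].
Proof.
split=> [[a ->]|[A [B [-> rA BA]]]].
  rewrite prod_det_fourier; do 2!eexists; split; first by [].
    by rewrite -implybE; apply/implyP=> /(dvdz_sum_circ pr_r)/dvdz_det_circ.
  exact: GA1_det_congr.
(* The rank one argument divides by [A]; for [A = 0] the zero coefficient function gives [D = 0]. *)
have [->|A0] := eqVneq A 0.
  rewrite mul0r; exists (fun=> 0); rewrite prod_det_fourier.
  rewrite (_ : circ _ = 0) ?det0 ?mul0r //.
  by apply/matrixP=> i j; rewrite !mxE big1.
move: BA; rewrite eqz_mod_dvd => /dvdzP[s /(canRL (subrK _)) ->].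
rewrite addrC -cardF; apply: GA1_det_realize => //.
exact: circ_cofactor1P.
Qed.

End GroupDeterminant.

Theorem theorem4 (k : nat) (hk : (2 <= k)%N) (hr : prime (2 ^ k - 1))
  (F : finFieldType) (hF : #|F| = (2 ^ k)%N) (D : int) :
  int_group_det (GA1 F) D <->
  exists A B : int,
    [/\ D = A * B ^+ (2 ^ k - 1),
        ~~ ((2 ^ k - 1)%:Z %| A)%Z || (((2 ^ k - 1) ^ 2)%:Z %| A)%Z
      & (B == A %[mod (2 ^ k)%:Z])%Z].
Proof.
have k_gt0 : (0 < k)%N by apply: ltnW.
have psi0 := sign_char0 F k; have psiD := sign_charD k_gt0 hF.
have sum_psi := sum_sign_char k_gt0 hF.
have odd_r : odd (2 ^ k - 1).
  by rewrite oddB ?expn_gt0 // oddX; case: k k_gt0 {hk hr hF psi0 psiD sum_psi}.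
(* The form [n.+2] gives ['I_n.+2] its ring structure of integers modulo [r]. *)
have [n rE] : exists n, (2 ^ k - 1)%N = n.+2.
  by exists (2 ^ k - 1).-2; case: (2 ^ k - 1)%N hr => [|[|]].
have qE : (2 ^ k)%N = n.+3 by rewrite -rE subn1 prednK // expn_gt0.
have cardF : #|F| = n.+3 by rewrite hF.
rewrite rE in hr odd_r *; rewrite qE.
(* As [r] is prime, any element other than 0 and 1 has order exactly [r], so it serves as [zeta]. *)
have [x x0 x1] : exists2 x : F, x != 0 & x != 1.
  have : [set~ (0 : F)] :\ 1 != set0.
    rewrite -card_gt0 -(ltn_add2l (1 \in [set~ (0 : F)])) -cardsD1 cardsC1 cardF.
    by rewrite addn0; case: (_ \in _).
  by case/set0Pn => x; rewrite !inE => /andP[]; exists x.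
have prim_x : n.+2.-primitive_root x.
  have xr : x ^+ n.+2 = 1.
    by apply: (mulfI x0); rewrite mulr1 -exprS -cardF expf_card.
  have [m prim_m] := prim_order_exists (isT : 0 < n.+2)%N xr.
  case/primeP: hr => _ /[apply] /orP[]/eqP m_eq; last by rewrite -m_eq.
  by move: prim_m x1; rewrite m_eq => /prim_expr_order; rewrite expr1 => ->; rewrite eqxx.
exact: (int_group_det_GA1 hr odd_r prim_x cardF psi0 psiD sum_psi).
Qed.
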